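(* Let $\{1,B(x),B^2(x),\dots\}=\{B^k(x)\}_{k\ge 0}$ constitute a basis for polynomial space, and let $n\in\mathbb N\cup\{0\}$. Then a differential operator representation of $\mathfrak{sl}(2,\mathbb R)$ modules on these polynomials is given by $$\mathbf h=\frac{B}{B'}D-\frac n2,\qquad \mathbf e=\frac{D}{B'},\qquad \mathbf f=\frac{B^2}{B'}D-nB,$$ that is, these operators satisfy the commutation relations of $\mathfrak{sl}(2,\mathbb R)$ $$[\mathbf e,\mathbf f]=2\mathbf h,\qquad [\mathbf h,\mathbf e]=-\mathbf e,\qquad [\mathbf h,\mathbf f]=\mathbf f .$$
   Context: $B=B(x)$ is allowed to be any kind of smooth function of $x$, with no further limitation (in particular it is not required to be a polynomial of degree at most 2). $B'(x)$ is the derivative of $B(x)$ and $D=\frac{d}{dx}$ is the derivative operator with respect to $x$; $\frac{D}{B'}$ means $\frac{1}{B'}D$. ''Polynomial space'' is the infinite-dimensional polynomial space. Functions are identified with the corresponding multiplication operators, and $[S,T]=ST-TS$. *)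

(* Defs.v *)
From mathcomp Require Import all_boot all_order all_algebra.
From mathcomp Require Import all_classical all_reals all_analysis.
Set Implicit Arguments.
Unset Strict Implicit.
Unset Printing Implicit Defensive.
Import Order.TTheory GRing.Theory Num.Theory.
Import numFieldNormedType.Exports.
Local Open Scope classical_set_scope.
Local Open Scope ring_scope.

(* A function on a set [U] of reals is represented by a total function
   [R -> R], and equality of such functions is [{in U, f =1 g}].  All the sets
   [U] used below are open, so derivatives at points of [U] only depend on the
   values on [U]. *)

Definition smooth_on (R : realType) (U : set R) : set (R -> R) :=
  [set f | forall (k : nat) (x : R), U x -> derivable (derive1n k f) x 1].

Definition is_subspace (R : realType) (V : set (R -> R)) : Prop :=
  V (fun=> 0) /\
  forall (a : R) (f g : R -> R), V f -> V g -> V (fun x => a * f x + g x).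

Definition spans_on (R : realType) (U : set R) (b : nat -> R -> R)
    (V : set (R -> R)) : Prop :=
  forall f, V f -> exists (N : nat) (c : nat -> R),
    {in U, f =1 (fun x => \sum_(k < N) c k * b k x)}.

Definition free_on (R : realType) (U : set R) (b : nat -> R -> R) : Prop :=
  forall (N : nat) (c : nat -> R),
    {in U, (fun x => \sum_(k < N) c k * b k x) =1 (fun=> 0)} ->
    forall k, (k < N)%N -> c k = 0.

Definition is_basis_on (R : realType) (U : set R) (b : nat -> R -> R)
    (V : set (R -> R)) : Prop :=
  [/\ is_subspace V, forall k, V (b k), spans_on U b V & free_on U b].

(* The points of [U] at which the coefficient 1 / B' is defined. *)
Definition regular_set (R : realType) (U : set R) (B : R -> R) : set R :=
  [set x | U x /\ derive1 B x != 0].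

Definition op_h (R : realType) (B : R -> R) (n : nat) (f : R -> R) : R -> R :=
  fun x => B x / derive1 B x * derive1 f x - n%:R / 2 * f x.

Definition op_e (R : realType) (B : R -> R) (f : R -> R) : R -> R :=
  fun x => (derive1 B x)^-1 * derive1 f x.

Definition op_f (R : realType) (B : R -> R) (n : nat) (f : R -> R) : R -> R :=
  fun x => B x ^+ 2 / derive1 B x * derive1 f x - n%:R * B x * f x.

Definition commutator (R : realType) (S T : (R -> R) -> R -> R) (f : R -> R) :
    R -> R :=
  fun x => S (T f) x - T (S f) x.

(* [T] induces a linear endomorphism of the space of restrictions to [U] of the
   members of [W]: it respects equality on [U], maps [W] to itself and is
   linear, the last two up to equality on [U]. *)
Definition is_endo_on (R : realType) (U : set R) (W : set (R -> R))
    (T : (R -> R) -> R -> R) : Prop :=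
  [/\ forall f g, {in U, f =1 g} -> {in U, T f =1 T g},
      forall f, W f -> exists2 g, W g & {in U, T f =1 g}
    & forall (a : R) f g, W f -> W g ->
        {in U, T (fun x => a * f x + g x) =1 (fun x => a * T f x + T g x)}].

(* The restrictions to [U] of the members of [W] form an sl(2, R)-module, in
   the presentation [e, f] = 2 h, [h, e] = - e, [h, f] = f. *)
Definition sl2_representation (R : realType) (U : set R) (W : set (R -> R))
    (h e f : (R -> R) -> R -> R) : Prop :=
  [/\ is_subspace W,
      [/\ is_endo_on U W h, is_endo_on U W e & is_endo_on U W f]
    & forall u, W u ->
      [/\ {in U, commutator e f u =1 (fun x => 2 * h u x)},
          {in U, commutator h e u =1 (fun x => - e u x)}
        & {in U, commutator h f u =1 f u}]].

(* Main.v *)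
Require Import Defs.
From mathcomp Require Import all_boot all_order all_algebra.
From mathcomp Require Import all_classical all_reals all_analysis.
From mathcomp Require Import ring.
Set Implicit Arguments.
Unset Strict Implicit.
Unset Printing Implicit Defensive.
Import Order.TTheory GRing.Theory Num.Theory.
Import numFieldNormedType.Exports.
Local Open Scope classical_set_scope.
Local Open Scope ring_scope.

(** Write [E] for the operator [D / B'].  Where [B'] does not vanish, [E] is a
    derivation of the algebra of functions and [E B = 1] ([op_eM],
    [op_e_self]), so [E] behaves as the derivative with respect to the
    variable [B], and the three operators are the classical ones on the line,
    [h = B E - n / 2], [e = E] and [f = B^2 E - n B].  At a given point the
    commutation relations then become polynomial identities in the values of
    [B], [u], [E u] and [E (E u)].

    This works on any space of smooth functions that is stable under [E] and
    under multiplication by [B] ([sl2_representation_of_stable]), and both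
    spaces of the theorem are of that kind.  On [U] a member of [V] is
    [p \o B] for a polynomial [p], and where [B'] does not vanish
    [E (p \o B) = p^`() \o B] and [B * (p \o B) = ('X p) \o B].
    For the space of all smooth functions what is needed is that sums, products
    and inverses of smooth functions are smooth.  This follows from a
    coinductive characterization of smoothness: a family of differentiable
    functions that is closed under derivation consists of smooth functions
    ([smooth_on_coind]). *)

(** * Smooth functions on an open set *)

Section Smooth.
Variables (R : realType) (O : set R).
Hypothesis openO : open O.
Implicit Types (f g : R -> R) (x : R).

Lemma eq_on_near f g x : {in O, f =1 g} -> O x -> \near x, f x = g x.
Proof.
move=> fg Ox; have : \forall y \near x, O y by exact: open_nbhs_nbhs.
by apply: filterS => y Oy; apply: fg; exact: mem_set.
Qed.

Lemma eq_on_derivable f g x :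
  {in O, f =1 g} -> O x -> derivable f x 1 -> derivable g x 1.
Proof. by move=> fg Ox; apply: near_eq_derivable; exact: eq_on_near. Qed.

Lemma eq_on_derive1 f g : {in O, f =1 g} -> {in O, derive1 f =1 derive1 g}.
Proof.
move=> fg x /set_mem Ox; rewrite !derive1E.
by apply: near_eq_derive; exact: eq_on_near.
Qed.

(** By iteration each derivative of a member is again, on [O], a member, hence
    differentiable.  Closure under derivation is only required up to equality on
    [O], because the usual rules compute derivatives at the points of [O]
    alone. *)
Lemma smooth_on_coind (W : set (R -> R)) :
    (forall f, W f -> forall x, O x -> derivable f x 1) ->
    (forall f, W f -> exists2 g, W g & {in O, derive1 f =1 g}) ->
  W `<=` smooth_on O.
Proof.
move=> derW stableW f Wf k x Ox.
have [g Wg fg] : exists2 g, W g & {in O, derive1n k f =1 g}.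
  elim: k => [|k [g Wg fg]]; first by exists f.
  have [h Wh gh] := stableW g Wg; exists h => // y Oy.
  by rewrite derive1nS (eq_on_derive1 fg) // gh.
apply: (@eq_on_derivable g) => //; last exact: derW.
by move=> y Oy; rewrite fg.
Qed.

Lemma smooth_on_derivable f x : smooth_on O f -> O x -> derivable f x 1.
Proof. by move=> /(_ 0 x). Qed.

Lemma smooth_on_derive1 f : smooth_on O f -> smooth_on O (derive1 f).
Proof. by move=> sf k x Ox; rewrite -derive1Sn; exact: sf. Qed.

Lemma smooth_on_cst c : smooth_on O (cst c).
Proof.
apply: (@smooth_on_coind (range (fun a : R => cst a))); last by exists c.
- by move=> _ [a _ <-] x _; exact: derivable_cst.
- move=> _ [a _ <-]; exists (cst 0); first by exists 0.
  by move=> x _; rewrite derive1_cst.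
Qed.

Lemma eq_on_smooth f g : {in O, f =1 g} -> smooth_on O f -> smooth_on O g.
Proof.
move=> fg sf.
apply: (@smooth_on_coind [set g | exists2 f, smooth_on O f & {in O, f =1 g}]);
  last by exists f.
- move=> k [l sl lk] x Ox; apply: (eq_on_derivable lk Ox).
  exact: smooth_on_derivable.
- move=> k [l sl lk]; exists (derive1 l).
    by exists (derive1 l); [exact: smooth_on_derive1|].
  by move=> x Ox; rewrite (eq_on_derive1 lk).
Qed.

(** Closing the smooth functions under all three operations at once turns their
    differentiation rules into closure under derivation, so that
    [smooth_on_coind] applies with no induction on the order of the
    derivative. *)
Inductive smooth_expr : (R -> R) -> Prop :=
| SmoothAtom f : smooth_on O f -> smooth_expr f
| SmoothAdd f g :
    smooth_expr f -> smooth_expr g -> smooth_expr (fun x => f x + g x)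
| SmoothMul f g :
    smooth_expr f -> smooth_expr g -> smooth_expr (fun x => f x * g x)
| SmoothInv f : (forall x, O x -> f x != 0) ->
    smooth_expr f -> smooth_expr (fun x => (f x)^-1).

Lemma smooth_expr_derive f : smooth_expr f ->
  exists2 g, smooth_expr g & forall x, O x -> is_derive x 1 f (g x).
Proof.
elim=> {f} [f sf|f g ef [f' ef' df] eg [g' eg' dg]
  |f g ef [f' ef' df] eg [g' eg' dg]|f f0 ef [f' ef' df]].
- exists (derive1 f); first by apply: SmoothAtom; exact: smooth_on_derive1.
  move=> x Ox; rewrite derive1E; apply: DeriveDef => //.
  exact: smooth_on_derivable.
- exists (fun x => f' x + g' x); first exact: SmoothAdd.
  by move=> x Ox; have := df x Ox; have := dg x Ox => ? ?; exact: is_deriveD.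
- exists (fun x => f x * g' x + g x * f' x).
    by apply: SmoothAdd; exact: SmoothMul.
  by move=> x Ox; have := df x Ox; have := dg x Ox => ? ?; exact: is_deriveM.
- exists (fun x => -1 * ((f x)^-1 * (f x)^-1) * f' x).
    apply: SmoothMul => //; apply: SmoothMul.
      by apply: SmoothAtom; exact: smooth_on_cst.
    by apply: SmoothMul; exact: SmoothInv.
  move=> x Ox; rewrite mulN1r -invfM -expr2.
  by apply: is_deriveV; [exact: f0|exact: df].
Qed.

Lemma smooth_expr_smooth f : smooth_expr f -> smooth_on O f.
Proof.
move: f; apply: smooth_on_coind => f /smooth_expr_derive[g eg dg].
- by move=> x Ox; have [] := dg x Ox.
- exists g => // x /set_mem Ox; rewrite derive1E.
  by have [] := dg x Ox.
Qed.

Lemma smooth_onD f g :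
  smooth_on O f -> smooth_on O g -> smooth_on O (fun x => f x + g x).
Proof.
by move=> sf sg; apply: smooth_expr_smooth; apply: SmoothAdd; exact: SmoothAtom.
Qed.

Lemma smooth_onM f g :
  smooth_on O f -> smooth_on O g -> smooth_on O (fun x => f x * g x).
Proof.
by move=> sf sg; apply: smooth_expr_smooth; apply: SmoothMul; exact: SmoothAtom.
Qed.

Lemma smooth_onV f : (forall x, O x -> f x != 0) ->
  smooth_on O f -> smooth_on O (fun x => (f x)^-1).
Proof.
by move=> f0 sf; apply: smooth_expr_smooth; apply: SmoothInv => //;
  exact: SmoothAtom.
Qed.

Lemma smooth_on_horner (p : {poly R}) f :
  smooth_on O f -> smooth_on O (fun x => p.[f x]).
Proof.
move=> sf; elim/poly_ind: p => [|p c IHp].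
  apply: (@eq_on_smooth (cst 0)); last exact: smooth_on_cst.
  by move=> x _; rewrite horner0.
apply: (@eq_on_smooth (fun x => p.[f x] * f x + c)).
  by move=> x _; rewrite hornerMXaddC.
by apply: smooth_onD; [exact: smooth_onM|exact: smooth_on_cst].
Qed.

Lemma smooth_on_subspace : is_subspace (smooth_on O).
Proof.
split; first exact: smooth_on_cst.
move=> a f g sf sg; apply: smooth_onD sg.
by apply: smooth_onM sf; exact: smooth_on_cst.
Qed.

End Smooth.

Lemma smooth_on_sub (R : realType) (U O : set R) (f : R -> R) :
  O `<=` U -> smooth_on U f -> smooth_on O f.
Proof. by move=> OU sf k x /OU; exact: sf. Qed.

Lemma open_regular_set (R : realType) (U : set R) (B : R -> R) :
  open U -> smooth_on U B -> open (regular_set U B).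
Proof.
move=> openU sB; rewrite openE => x [Ux B'x].
have : \forall y \near x, U y by exact: open_nbhs_nbhs.
have /derivable1_diffP/differentiable_continuous cB' : derivable (derive1 B) x 1.
  exact: (sB 1%N x).
have : \forall y \near x, derive1 B y != 0.
  by apply: (cB' [set y | y != 0]); apply: open_nbhs_nbhs; split => //;
    exact: open_neq.
by apply: filterS2 => y B'y Uy; split.
Qed.

(** * The derivation D / B' *)

Section Derivation.
Variables (R : realType) (B : R -> R).
Implicit Types (f g : R -> R) (x a : R).

Lemma op_e_cst a x : op_e B (cst a) x = 0.
Proof. by rewrite /op_e derive1_cst mulr0. Qed.

Lemma op_e_self x : derive1 B x != 0 -> op_e B B x = 1.
Proof. exact: mulVf. Qed.

Lemma derivable_mulfun f g x : derivable f x 1 -> derivable g x 1 ->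
  derivable (fun y => f y * g y) x 1.
Proof. exact: derivableM. Qed.

Lemma derivable_scalefun a f x : derivable f x 1 ->
  derivable (fun y => a * f y) x 1.
Proof. exact: (derivable_mulfun (derivable_cst a x 1)). Qed.

Lemma op_e_is_derive f x df : is_derive x 1 f df ->
  op_e B f x = (derive1 B x)^-1 * df.
Proof. by move=> dfx; rewrite /op_e [derive1 f x]derive1E derive_val. Qed.

Lemma derivable_is_derive f x : derivable f x 1 ->
  is_derive x 1 f (derive1 f x).
Proof. by move=> df; rewrite derive1E; apply: DeriveDef. Qed.

Lemma op_eD f g x : derivable f x 1 -> derivable g x 1 ->
  op_e B (fun y => f y + g y) x = op_e B f x + op_e B g x.
Proof.
move=> /derivable_is_derive df /derivable_is_derive dg.
by rewrite (op_e_is_derive (is_deriveD df dg)) mulrDr.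
Qed.

Lemma op_eM f g x : derivable f x 1 -> derivable g x 1 ->
  op_e B (fun y => f y * g y) x = op_e B f x * g x + f x * op_e B g x.
Proof.
move=> /derivable_is_derive df /derivable_is_derive dg.
rewrite (op_e_is_derive (is_deriveM df dg)) /op_e /GRing.scale /=.
move: (derive1 f x) (derive1 g x) (derive1 B x)^-1 => f' g' b.
by ring.
Qed.

Lemma op_eZ a f x : derivable f x 1 ->
  op_e B (fun y => a * f y) x = a * op_e B f x.
Proof.
move=> df; rewrite (op_eM (derivable_cst a x 1) df).
by rewrite op_e_cst mul0r add0r.
Qed.

Lemma op_e_horner (p : {poly R}) x : derive1 B x != 0 -> derivable B x 1 ->
  op_e B (fun y => p.[B y]) x = (p^`()).[B x].
Proof.
move=> B'x dB; have dp := is_derive_poly p (B x).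
rewrite (op_e_is_derive (is_derive1_comp dp (derivable_is_derive dB))).
by rewrite mulrCA mulVf ?mulr1.
Qed.

Lemma op_hE n f x : op_h B n f x = B x * op_e B f x - n%:R / 2 * f x.
Proof. by rewrite /op_h /op_e mulrA. Qed.

Lemma op_fE n f x :
  op_f B n f x = B x ^+ 2 * op_e B f x - n%:R * B x * f x.
Proof. by rewrite /op_f /op_e mulrA. Qed.

End Derivation.

(** * Spaces stable under D / B' and multiplication by B *)

Section Stable.
Variables (R : realType) (O : set R) (B : R -> R) (n : nat).
Hypothesis openO : open O.
Hypothesis smoothB : smooth_on O B.
Hypothesis B'neq0 : forall x, O x -> derive1 B x != 0.
Implicit Types (f g u : R -> R) (x a : R).

Lemma smooth_on_op_e f : smooth_on O f -> smooth_on O (op_e B f).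
Proof.
move=> sf; apply: (smooth_onM openO _ (smooth_on_derive1 sf)).
exact (smooth_onV openO B'neq0 (smooth_on_derive1 smoothB)).
Qed.

Lemma op_e_op_h u x : smooth_on O u -> O x ->
  op_e B (op_h B n u) x =
    op_e B u x + B x * op_e B (op_e B u) x - n%:R / 2 * op_e B u x.
Proof.
move=> su Ox; have dB := smooth_on_derivable smoothB Ox.
have du := smooth_on_derivable su Ox.
have deu := smooth_on_derivable (smooth_on_op_e su) Ox.
have -> : op_h B n u = fun y => B y * op_e B u y + - (n%:R / 2) * u y.
  by apply/funext => y; rewrite op_hE mulNr.
rewrite (op_eD _ (derivable_mulfun dB deu) (derivable_scalefun du)).
rewrite (op_eM _ dB deu) (op_eZ _ _ du) (op_e_self (B'neq0 Ox)).
by rewrite mul1r mulNr.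
Qed.

Lemma op_e_op_f u x : smooth_on O u -> O x ->
  op_e B (op_f B n u) x =
    2 * B x * op_e B u x + B x ^+ 2 * op_e B (op_e B u) x
    - n%:R * (u x + B x * op_e B u x).
Proof.
move=> su Ox; have dB := smooth_on_derivable smoothB Ox.
have du := smooth_on_derivable su Ox.
have deu := smooth_on_derivable (smooth_on_op_e su) Ox.
have -> : op_f B n u =
    fun y => B y * (B y * op_e B u y) + - n%:R * (B y * u y).
  by apply/funext => y; rewrite op_fE expr2; ring.
have dBu := derivable_mulfun dB du; have dBeu := derivable_mulfun dB deu.
rewrite (op_eD _ (derivable_mulfun dB dBeu) (derivable_scalefun dBu)).
rewrite (op_eZ _ _ dBu) (op_eM _ dB dBeu) (op_eM _ dB deu) (op_eM _ dB du).
rewrite (op_e_self (B'neq0 Ox)).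
by ring.
Qed.

Lemma sl2_relations u x : smooth_on O u -> O x ->
  [/\ commutator (op_e B) (op_f B n) u x = 2 * op_h B n u x,
      commutator (op_h B n) (op_e B) u x = - op_e B u x
    & commutator (op_h B n) (op_f B n) u x = op_f B n u x].
Proof.
move=> su Ox; rewrite /commutator; split.
- by rewrite op_e_op_f // op_fE op_hE; field.
- by rewrite op_e_op_h // op_hE; ring.
- rewrite op_hE op_e_op_f // [op_f B n (op_h B n u) x]op_fE op_e_op_h //.
  by rewrite op_fE op_hE; ring.
Qed.

Lemma op_e_endo (W : set (R -> R)) :
    W `<=` smooth_on O ->
    (forall f, W f -> exists2 g, W g & {in O, op_e B f =1 g}) ->
  is_endo_on O W (op_e B).
Proof.
move=> Wsmooth stableW; split=> //.
- by move=> f g fg x Ox; rewrite /op_e (eq_on_derive1 openO fg).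
- move=> a f g /Wsmooth sf /Wsmooth sg x /set_mem Ox.
  have df := smooth_on_derivable sf Ox; have dg := smooth_on_derivable sg Ox.
  by rewrite (op_eD _ (derivable_scalefun df) dg) (op_eZ _ _ df).
Qed.

(** Stability under [e] and under multiplication by [B] is all that has to be
    checked, since [h] and [f] are polynomial expressions in these two
    operators; smoothness is what lets [e] act as a derivation twice. *)
Lemma sl2_representation_of_stable (W : set (R -> R)) :
    is_subspace W -> W `<=` smooth_on O ->
    (forall f, W f -> exists2 g, W g & {in O, op_e B f =1 g}) ->
    (forall f, W f -> exists2 g, W g & {in O, (fun x => B x * f x) =1 g}) ->
  sl2_representation O W (op_h B n) (op_e B) (op_f B n).
Proof.
move=> subW Wsmooth stable_e stable_B; have [_ Wlin] := subW.
have endo_e := op_e_endo Wsmooth stable_e.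
have [e_eq _ e_lin] := endo_e.
split=> //.
- split=> //.
  + split.
    * by move=> f g fg x Ox; rewrite !op_hE (e_eq _ _ fg) // fg.
    * move=> f Wf; have [g Wg eg] := stable_e f Wf.
      have [k Wk Bk] := stable_B g Wg.
      exists (fun x => - (n%:R / 2) * f x + k x); first exact: Wlin.
      by move=> x Ox; rewrite op_hE eg // -Bk // addrC mulNr.
    * by move=> a f g Wf Wg x Ox; rewrite !op_hE e_lin //; ring.
  + split.
    * by move=> f g fg x Ox; rewrite !op_fE (e_eq _ _ fg) // fg.
    * move=> f Wf; have [g Wg eg] := stable_e f Wf.
      have [k Wk Bk] := stable_B g Wg.
      have [l Wl Bl] := stable_B k Wk.
      have [m Wm Bm] := stable_B f Wf.
      exists (fun x => - n%:R * m x + l x); first exact: Wlin.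
      by move=> x Ox; rewrite op_fE eg // -Bl // -Bk // -Bm //; ring.
    * by move=> a f g Wf Wg x Ox; rewrite !op_fE e_lin //; ring.
- move=> u /Wsmooth su; split=> x /set_mem Ox.
  + by have [] := sl2_relations su Ox.
  + by have [] := sl2_relations su Ox.
  + by have [] := sl2_relations su Ox.
Qed.

End Stable.

(** * The span of the powers of B *)

Section PolynomialsInB.
Variables (R : realType) (U : set R) (B : R -> R) (V : set (R -> R)).

Lemma horner_in_subspace (p : {poly R}) :
    is_subspace V -> (forall k, V (fun x => B x ^+ k)) ->
  V (fun x => p.[B x]).
Proof.
move=> [V0 Vlin] powV.
have -> : (fun x => p.[B x]) = fun x => \sum_(i < size p) p`_i * B x ^+ i.
  by apply/funext => x; rewrite horner_coef.
elim: (size p) => [|m IHm].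
  by under eq_fun do rewrite big_ord0.
by under eq_fun do rewrite big_ord_recr /= addrC; exact: Vlin.
Qed.

Lemma spans_on_horner f : spans_on U (fun k x => B x ^+ k) V -> V f ->
  exists p : {poly R}, {in U, f =1 (fun x => p.[B x])}.
Proof.
move=> spanV /spanV[N [c fc]]; exists (\poly_(i < N) c i) => x Ux.
by rewrite horner_poly fc.
Qed.

End PolynomialsInB.

Theorem proposition5 (R : realType) (U : set R) (B : R -> R)
    (V : set (R -> R)) (n : nat)
    (openU : open U)
    (smoothB : smooth_on U B)
    (basisV : is_basis_on U (fun k x => B x ^+ k) V) :
  sl2_representation (regular_set U B) V (op_h B n) (op_e B) (op_f B n) /\
  sl2_representation (regular_set U B) (smooth_on (regular_set U B))
    (op_h B n) (op_e B) (op_f B n).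
Proof.
have openO := open_regular_set openU smoothB.
have OU : regular_set U B `<=` U by move=> x [].
have sB := smooth_on_sub OU smoothB.
have B'0 x : regular_set U B x -> derive1 B x != 0 by case.
split; apply: (sl2_representation_of_stable n openO sB B'0).
- by case: basisV.
- move=> f; case: basisV => _ _ spanV _ /(spans_on_horner spanV)[p fp].
  apply: (@eq_on_smooth _ _ openO (fun x => p.[B x])).
    by move=> x /set_mem/OU Ux; rewrite fp //; exact: mem_set.
  exact: smooth_on_horner.
- move=> f; case: basisV => subV powV spanV _ /(spans_on_horner spanV)[p fp].
  exists (fun x => (p^`()).[B x]); first exact: horner_in_subspace.
  move=> x xO; have Ox := set_mem xO.
  rewrite -op_e_horner; [|exact: B'0|exact: smooth_on_derivable sB Ox].
  rewrite /op_e (eq_on_derive1 openU fp) //; exact/mem_set/OU.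
- move=> f; case: basisV => subV powV spanV _ /(spans_on_horner spanV)[p fp].
  exists (fun x => (p * 'X).[B x]); first exact: horner_in_subspace.
  move=> x /set_mem/OU Ux; rewrite hornerMX mulrC fp //; exact: mem_set.
- exact: smooth_on_subspace.
- by [].
- by move=> f sf; exists (op_e B f); [exact: smooth_on_op_e|].
- by move=> f sf; exists (fun x => B x * f x); [exact: smooth_onM|].
Qed.
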